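(* Let $D\subset\mathbb{C}^n$ be invariant with respect to complex conjugation. For every $H\in\mathcal{P}(n)$, $$\mathcal{S}_H(\Omega_D)=\Big\{\mathcal{I}(F): F\in Stem(D),\ F=\sum_{K\subset H^c}e_KF_K+\sum_{h\in H}\ \sum_{Q\subset\{h+1,\dots,n\}\setminus H}e_{\{h\}\cup Q}F_{\{h\}\cup Q}\Big\}.$$ In particular, for any $h\in\{1,\dots,n\}$, $$\mathcal{S}_h(\Omega_D)=\Big\{\mathcal{I}(F): F\in Stem(D),\ F=\sum_{K\in\mathcal{P}(n),\,h\notin K}e_KF_K+\sum_{Q\subset\{h+1,\dots,n\}}e_{\{h\}\cup Q}F_{\{h\}\cup Q}\Big\}.$$ Equivalently, $f=\mathcal{I}(F)\in\mathcal{S}_H(\Omega_D)$ if and only if $F_{P\cup\{h\}\cup Q}=0$ for all $h\in H$, all $Q\subset\{h+1,\dots,n\}$ and all $P\in\mathcal{P}(h-1)$ with $P\neq\emptyset$.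
   Context: $\mathbb{H}$ is the algebra of quaternions, $\mathbb{S}_{\mathbb{H}}=\{q\in\mathbb{H}: q^2=-1\}$. $n\ge1$; $\mathcal{P}(m)$ is the set of subsets of $\{1,\dots,m\}$ ($\mathcal{P}(0)=\{\emptyset\}$); $H^c=\{1,\dots,n\}\setminus H$. For $K=\{k_1<\dots<k_p\}\in\mathcal{P}(n)$ and quaternions $q_{k_1},\dots,q_{k_p}$, put $q_K=q_{k_1}\cdots q_{k_p}$ ($q_\emptyset=1$), and $[q_K,a]=q_K\,a$ for $a\in\mathbb{H}$. For $z\in\mathbb{C}^n$, $\overline{z}^h$ is $z$ with its $h$-th coordinate conjugated. $D\subset\mathbb{C}^n$ is invariant with respect to complex conjugation if $z\in D\iff\overline{z}^h\in D$ for every $h$. Its circularization is $\Omega_D=\{(\alpha_l+J_l\beta_l)_{l=1}^n: (\alpha_l+i\beta_l)_{l=1}^n\in D,\ J_1,\dots,J_n\in\mathbb{S}_{\mathbb{H}}\}\subset\mathbb{H}^n$. Let $\{e_K\}_{K\in\mathcal{P}(n)}$ be a basis of $\mathbb{R}^{2^n}$. A stem function is $F=\sum_{K}e_KF_K:D\to\mathbb{H}\otimes\mathbb{R}^{2^n}$, $F_K:D\to\mathbb{H}$, with $F_K(\overline{z}^h)=(-1)^{|K\cap\{h\}|}F_K(z)$ for all $K,h,z$; $Stem(D)$ is the set of these. $F$ induces the slice function $f=\mathcal{I}(F):\Omega_D\to\mathbb{H}$, $f(x)=\sum_K[J_K,F_K(z)]$ for $x=(\alpha_l+J_l\beta_l)_l$,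 $z=(\alpha_l+i\beta_l)_l\in D$. $\mathcal{S}(\Omega_D)$ is the set of slice functions; each slice function is induced by a unique stem function. One variable: for $E\subset\mathbb{C}$ conjugation invariant and $\Omega_E=\{\alpha+J\beta:\alpha+i\beta\in E, J\in\mathbb{S}_{\mathbb{H}}\}$, a function $g:\Omega_E\to\mathbb{H}$ is slice if $g(\alpha+J\beta)=G_1(\alpha+i\beta)+J\,G_2(\alpha+i\beta)$ for functions $G_1,G_2:E\to\mathbb{H}$ with $G_1(\overline w)=G_1(w)$, $G_2(\overline w)=-G_2(w)$. For $y\in\Omega_D$ let $\Omega_{D,h}(y)=\{x\in\mathbb{H}:(y_1,\dots,y_{h-1},x,y_{h+1},\dots,y_n)\in\Omega_D\}$ (a set of the form $\Omega_E$) and $f^y_h:\Omega_{D,h}(y)\to\mathbb{H}$, $f^y_h(x)=f(y_1,\dots,y_{h-1},x,y_{h+1},\dots,y_n)$. $\mathcal{S}_h(\Omega_D)$ is the set of $f\in\mathcal{S}(\Omega_D)$ such that $f^y_h$ is a one-variable slice function for every $y\in\Omega_D$ ($f$ is slice w.r.t. $x_h$), and $\mathcal{S}_H(\Omega_D)=\bigcap_{h\in H}\mathcal{S}_h(\Omega_D)$ (understood as $\mathcal{S}(\Omega_D)$ if $H=\emptyset$). *)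

(* Defs.v *)
From HB Require Import structures.
From mathcomp Require Import all_boot all_order all_algebra.
From mathcomp Require Import boolp classical_sets reals.
From mathcomp Require Import complex.
From mathcomp Require Import ring.

Set Implicit Arguments.
Unset Strict Implicit.
Unset Printing Implicit Defensive.

Import Order.TTheory GRing.Theory Num.Theory.
Local Open Scope classical_set_scope.
Local Open Scope ring_scope.

(* [Quat a b c d] is a + b i + c j + d k. *)
Record quat (R : Type) : Type := Quat { qre : R; qi : R; qj : R; qk : R }.

Definition quat_tuple (R : Type) (q : quat R) : R * R * R * R :=
  (qre q, qi q, qj q, qk q).
Definition tuple_quat (R : Type) (t : R * R * R * R) : quat R :=
  Quat t.1.1.1 t.1.1.2 t.1.2 t.2.
Lemma quat_tupleK (R : Type) : cancel (@quat_tuple R) (@tuple_quat R).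
Proof. by case. Qed.

HB.instance Definition _ (R : realType) :=
  Choice.copy (quat R) (can_type (@quat_tupleK R)).

Definition addq (R : realType) (p q : quat R) : quat R :=
  Quat (qre p + qre q) (qi p + qi q) (qj p + qj q) (qk p + qk q).
Definition oppq (R : realType) (p : quat R) : quat R :=
  Quat (- qre p) (- qi p) (- qj p) (- qk p).
Definition mulq (R : realType) (p q : quat R) : quat R :=
  Quat (qre p * qre q - qi p * qi q - qj p * qj q - qk p * qk q)
       (qre p * qi q + qi p * qre q + qj p * qk q - qk p * qj q)
       (qre p * qj q - qi p * qk q + qj p * qre q + qk p * qi q)
       (qre p * qk q + qi p * qj q - qj p * qi q + qk p * qre q).
Definition scaleq (R : realType) (a : R) (q : quat R) : quat R :=
  Quat (a * qre q) (a * qi q) (a * qj q) (a * qk q).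

Lemma addqA (R : realType) : associative (@addq R).
Proof. by move=> p q r; rewrite /addq /= !addrA. Qed.
Lemma addqC (R : realType) : commutative (@addq R).
Proof. by move=> p q; rewrite /addq; congr Quat; rewrite addrC. Qed.
Lemma add0q (R : realType) : left_id (Quat 0 0 0 0) (@addq R).
Proof. by case=> a b c d; rewrite /addq /= !add0r. Qed.
Lemma addNq (R : realType) : left_inverse (Quat 0 0 0 0) (@oppq R) (@addq R).
Proof. by move=> p; rewrite /addq /= !addNr. Qed.

HB.instance Definition _ (R : realType) :=
  GRing.isZmodule.Build (quat R)
    (@addqA R) (@addqC R) (@add0q R) (@addNq R).

Lemma mulqA (R : realType) : associative (@mulq R).
Proof. by move=> p q r; rewrite /mulq /=; congr Quat; ring. Qed.
Lemma mul1q (R : realType) : left_id (Quat 1 0 0 0) (@mulq R).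
Proof. by case=> a b c d; rewrite /mulq /=; congr Quat; ring. Qed.
Lemma mulq1 (R : realType) : right_id (Quat 1 0 0 0) (@mulq R).
Proof. by case=> a b c d; rewrite /mulq /=; congr Quat; ring. Qed.
Lemma mulqDl (R : realType) : left_distributive (@mulq R) +%R.
Proof. by move=> p q r; rewrite /mulq /=; congr Quat => /=; ring. Qed.
Lemma mulqDr (R : realType) : right_distributive (@mulq R) +%R.
Proof. by move=> p q r; rewrite /mulq /=; congr Quat => /=; ring. Qed.
Lemma oneq_neq0 (R : realType) : Quat 1 0 0 0 != 0 :> quat R.
Proof. by apply/eqP => -[/eqP]; rewrite oner_eq0. Qed.

HB.instance Definition _ (R : realType) :=
  GRing.Zmodule_isNzRing.Build (quat R)
    (@mulqA R) (@mul1q R) (@mulq1 R) (@mulqDl R) (@mulqDr R) (@oneq_neq0 R).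

Lemma scaleqA (R : realType) (a b : R) (q : quat R) :
  scaleq a (scaleq b q) = scaleq (a * b) q.
Proof. by rewrite /scaleq /= !mulrA. Qed.
Lemma scale1q (R : realType) : left_id 1 (@scaleq R).
Proof. by case=> a b c d; rewrite /scaleq /= !mul1r. Qed.
Lemma scaleqDr (R : realType) : right_distributive (@scaleq R) +%R.
Proof. by move=> a p q; rewrite /scaleq /=; congr Quat => /=; ring. Qed.
Lemma scaleqDl (R : realType) (q : quat R) :
  {morph (@scaleq R)^~ q : a b / a + b}.
Proof. by move=> a b; rewrite /scaleq /=; congr Quat => /=; ring. Qed.

HB.instance Definition _ (R : realType) :=
  GRing.Zmodule_isLmodule.Build R (quat R)
    (@scaleqA R) (@scale1q R) (@scaleqDr R) (@scaleqDl R).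

Lemma scaleqAl (R : realType) (a : R) (p q : quat R) :
  a *: (p * q) = (a *: p) * q.
Proof. by congr Quat => /=; ring. Qed.
HB.instance Definition _ (R : realType) :=
  GRing.Lmodule_isLalgebra.Build R (quat R) (@scaleqAl R).

Lemma scaleqAr (R : realType) (a : R) (p q : quat R) :
  a *: (p * q) = p * (a *: q).
Proof. by congr Quat => /=; ring. Qed.
HB.instance Definition _ (R : realType) :=
  GRing.Lalgebra_isAlgebra.Build R (quat R) (@scaleqAr R).

Definition sphere (R : realType) : set (quat R) := [set q | q ^+ 2 = -1].

(* The point alpha + J beta, where w = alpha + i beta. *)
Definition slice_pt (R : realType) (w : R[i]) (J : quat R) : quat R :=
  (complex.Re w)%:A + complex.Im w *: J.

Definition slice_ptn (R : realType) (n : nat) (z : 'rV[R[i]]_n)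
    (J : 'rV[quat R]_n) : 'rV[quat R]_n :=
  \row_l slice_pt (z 0 l) (J 0 l).

Definition conj_at (R : realType) (n : nat) (h : 'I_n) (z : 'rV[R[i]]_n) :
    'rV[R[i]]_n :=
  \row_l (if l == h then conjc (z 0 l) else z 0 l).

Definition conj_invariant (R : realType) (n : nat) (D : set 'rV[R[i]]_n) : Prop :=
  forall (h : 'I_n) (z : 'rV[R[i]]_n), D z <-> D (conj_at h z).

Definition sphere_tuples (R : realType) (n : nat) : set 'rV[quat R]_n :=
  [set J | forall l, sphere (J 0 l)].

Definition circularization (R : realType) (n : nat) (D : set 'rV[R[i]]_n) :
    set 'rV[quat R]_n :=
  [set slice_ptn (val p.1) p.2 |
    p in [set p : D * 'rV[quat R]_n | sphere_tuples p.2]].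

(* R^(2^n) is ['rV[R]_(2 ^ n)] and H (x) R^(2^n) is ['rV[quat R]_(2 ^ n)];
   [tens v a] is the pure tensor of a and v. *)
Definition tens (R : realType) (m : nat) (v : 'rV[R]_m) (a : quat R) :
    'rV[quat R]_m :=
  \row_j (v 0 j *: a).

Definition is_basis (R : realType) (n : nat)
    (e : {set 'I_n} -> 'rV[R]_(2 ^ n)) : Prop :=
  basis_of fullv (codom e).

(* The K-th component of t with respect to the basis e: the K-th coordinate form
   of e, extended by H-linearity (see [tens_component] and [component_sum_tens]). *)
Definition component (R : realType) (n : nat) (e : {set 'I_n} -> 'rV[R]_(2 ^ n))
    (t : 'rV[quat R]_(2 ^ n)) (K : {set 'I_n}) : quat R :=
  \sum_j coord (codom_tuple e) (enum_rank K) (delta_mx 0 j) *: t 0 j.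

Definition Stem (R : realType) (n : nat) (e : {set 'I_n} -> 'rV[R]_(2 ^ n))
    (D : set 'rV[R[i]]_n) : set (D -> 'rV[quat R]_(2 ^ n)) :=
  [set F | forall (K : {set 'I_n}) (h : 'I_n) (z w : D),
     val w = conj_at h (val z) ->
     component e (F w) K = (-1) ^+ #|K :&: [set h]%SET| * component e (F z) K].
Arguments Stem {R n} e D _.

(* The enumeration of 'I_n is increasing, so this is q_(k_1) * ... * q_(k_p)
   for K = {k_1 < ... < k_p}. *)
Definition ordered_prod (R : realType) (n : nat) (q : 'rV[quat R]_n)
    (K : {set 'I_n}) : quat R :=
  \prod_(k < n | k \in K) q 0 k.

Definition slice_value (R : realType) (n : nat)
    (e : {set 'I_n} -> 'rV[R]_(2 ^ n))
    (J : 'rV[quat R]_n) (t : 'rV[quat R]_(2 ^ n)) : quat R :=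
  \sum_(K : {set 'I_n}) ordered_prod J K * component e t K.

(* The slice function I(F).  A point of the circularization has several
   representations (z, J); one is chosen, and by [slice_ofE] the value does not
   depend on it when F is a stem function. *)
Definition slice_of (R : realType) (n : nat) (e : {set 'I_n} -> 'rV[R]_(2 ^ n))
    (D : set 'rV[R[i]]_n) (F : D -> 'rV[quat R]_(2 ^ n))
    (x : circularization D) : quat R :=
  let p := s2val (cid2 (set_mem (valP x))) in slice_value e p.2 (F p.1).

Definition SliceFun (R : realType) (n : nat)
    (e : {set 'I_n} -> 'rV[R]_(2 ^ n)) (D : set 'rV[R[i]]_n) :
    set (circularization D -> quat R) :=
  [set slice_of e F | F in Stem e D].
Arguments SliceFun {R n} e D _.

Definition conj_invariant1 (R : realType) (E : set R[i]) : Prop :=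
  forall w : R[i], E w <-> E (conjc w).

Definition circularization1 (R : realType) (E : set R[i]) : set (quat R) :=
  [set q | exists w J, [/\ E w, sphere J & q = slice_pt w J]].

Definition slice1 (R : realType) (U : set (quat R)) (g : U -> quat R) : Prop :=
  exists E : set R[i],
    [/\ conj_invariant1 E, U = circularization1 E &
      exists G1 G2 : E -> quat R,
        (forall v w : E, val w = conjc (val v) ->
           G1 w = G1 v /\ G2 w = - G2 v) /\
        (forall (w : E) (J : quat R) (x : U), sphere J ->
           val x = slice_pt (val w) J -> g x = G1 w + J * G2 w)].

Definition subst_at (R : realType) (n : nat) (h : 'I_n) (y : 'rV[quat R]_n)
    (x : quat R) : 'rV[quat R]_n :=
  \row_l (if l == h then x else y 0 l).

Definition section_dom (R : realType) (n : nat) (D : set 'rV[R[i]]_n) (h : 'I_n)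
    (y : 'rV[quat R]_n) : set (quat R) :=
  [set x | circularization D (subst_at h y x)].

Definition section_fun (R : realType) (n : nat) (D : set 'rV[R[i]]_n) (h : 'I_n)
    (y : 'rV[quat R]_n) (f : circularization D -> quat R)
    (x : section_dom D h y) : quat R :=
  f (SigSub (mem_set (set_mem (valP x)) :
       subst_at h y (val x) \in circularization D)).

(* The functions in S(Omega_D) that are slice with respect to x_h. *)
Definition SliceIn (R : realType) (n : nat) (e : {set 'I_n} -> 'rV[R]_(2 ^ n))
    (D : set 'rV[R[i]]_n) (h : 'I_n) : set (circularization D -> quat R) :=
  [set f | SliceFun e D f /\
     forall y : circularization D, slice1 (section_fun (h := h) (y := val y) f)].
Arguments SliceIn {R n} e D h _.

(* Intersecting with S(Omega_D) only matters when H is empty. *)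
Definition SliceInSet (R : realType) (n : nat)
    (e : {set 'I_n} -> 'rV[R]_(2 ^ n)) (D : set 'rV[R[i]]_n)
    (H : {set 'I_n}) : set (circularization D -> quat R) :=
  SliceFun e D `&` \bigcap_(h in [set` H]) SliceIn e D h.
Arguments SliceInSet {R n} e D H _.

Lemma component_sum_tens (R : realType) (n : nat)
    (e : {set 'I_n} -> 'rV[R]_(2 ^ n)) (a : {set 'I_n} -> quat R) :
  is_basis e ->
  forall K, component e (\sum_(L : {set 'I_n}) tens (e L) (a L)) K = a K.
Proof.
move=> be K; rewrite /component /tens.
have fe : free (codom_tuple e) by exact: (basis_free be).
under eq_bigr => j _ do rewrite summxE scaler_sumr.
rewrite exchange_big /=.
have H (L : {set 'I_n}) : \sum_(j < 2 ^ n)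
    coord (codom_tuple e) (enum_rank K) (delta_mx 0 j) *:
      (\row_j0 (e L 0 j0 *: a L)) 0 j = (L == K)%:R *: a L.
  under eq_bigr => j _ do rewrite mxE scalerA mulrC -linearZ.
  rewrite -scaler_suml -linear_sum -row_sum_delta.
  have -> : e L = (codom_tuple e)`_(enum_rank L).
    by rewrite /= /codom /image_mem (nth_map L) -?cardE ?ltn_ord // nth_enum_rank.
  congr (_ *: _); transitivity ((enum_rank L == enum_rank K)%:R : R).
    exact: coord_free fe.
  by rewrite (inj_eq enum_rank_inj).
under eq_bigr => L _ do rewrite H.
rewrite (bigD1 K) //= eqxx scale1r big1 ?addr0 // => L LK.
by rewrite (negPf LK) scale0r.
Qed.

Lemma tens_component (R : realType) (n : nat)
    (e : {set 'I_n} -> 'rV[R]_(2 ^ n)) (t : 'rV[quat R]_(2 ^ n)) :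
  is_basis e -> \sum_(K : {set 'I_n}) tens (e K) (component e t K) = t.
Proof.
move=> be; apply/rowP => i; rewrite summxE /tens /component.
under eq_bigr => K _ do rewrite mxE scaler_sumr.
rewrite exchange_big /=.
under eq_bigr => j _ do under eq_bigr => K _ do rewrite scalerA mulrC.
under eq_bigr => j _ do rewrite -scaler_suml.
have H (j : 'I_(2 ^ n)) : \sum_(K : {set 'I_n})
    coord (codom_tuple e) (enum_rank K) (delta_mx 0 j) * e K 0 i
    = (i == j)%:R :> R.
  transitivity ((delta_mx 0 j : 'rV[R]_(2 ^ n)) 0 i); last by rewrite mxE eqxx.
  have E : basis_of fullv (codom_tuple e) := be.
  have {}E := coord_basis E (memvf (delta_mx 0 j)).
  rewrite [RHS](congr1 (fun M : 'rV[R]_(2 ^ n) => M 0 i) E) summxE.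
  rewrite (reindex enum_rank) /=; last first.
    by exists enum_val => K _; rewrite ?enum_rankK ?enum_valK.
  apply: eq_bigr => K _; rewrite mxE; congr (_ * _).
  by rewrite /codom /image_mem (nth_map K) -?cardE ?ltn_ord // nth_enum_rank.
rewrite (bigD1 i) //= H eqxx scale1r big1 ?addr0 // => j ji.
by rewrite H eq_sym (negPf ji) scale0r.
Qed.

Lemma sphere_coord (R : realType) (J : quat R) : sphere J ->
  qre J = 0 /\ qi J ^+ 2 + qj J ^+ 2 + qk J ^+ 2 = 1.
Proof.
case: J => a b c d; rewrite /sphere /= expr2 => -[].
rewrite !oppr0 => h1 h2 h3 h4 /=.
have a0 : a = 0.
  apply/eqP/negP => /negP a0.
  have z x : a * x + x * a = 0 -> x = 0.
    rewrite (mulrC x) -mulr2n => /eqP; rewrite mulrn_eq0 /= mulf_eq0 (negPf a0).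
    by move/eqP.
  have b0 : b = 0 by apply: z; rewrite -h2; ring.
  have c0 : c = 0 by apply: z; rewrite -h3; ring.
  have d0 : d = 0 by apply: z; rewrite -h4; ring.
  move: h1; rewrite b0 c0 d0 !mulr0 !subr0 => h1.
  by have := sqr_ge0 a; rewrite expr2 h1 oppr_ge0 ler10.
split=> //; move: h1; rewrite a0 => h1.
by apply: oppr_inj; rewrite -h1; ring.
Qed.

Lemma slice_pt_eq (R : realType) (v w : R[i]) (J L : quat R) :
  sphere J -> sphere L -> slice_pt v J = slice_pt w L ->
  [\/ v = w /\ complex.Im v = 0, v = w /\ J = L | w = conjc v /\ L = - J].
Proof.
move=> /sphere_coord; case: J => a b c d /= [-> HJ].
move=> /sphere_coord; case: L => a' b' c' d' /= [-> HL].
case: v => x y; case: w => x' y'; rewrite /slice_pt /= => -[].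
rewrite !mulr0 !mulr1 !addr0 !add0r => <- hb hc hd.
have yy : y ^+ 2 = y' ^+ 2.
  rewrite -[LHS]mulr1 -[RHS]mulr1 -{1}HJ -HL !mulrDr -!exprMn.
  by rewrite hb hc hd.
have [y0|y0] := eqVneq y 0.
  apply: Or31; split=> //; congr Complex; rewrite y0.
  by move/eqP: yy; rewrite y0 expr0n /= eq_sym sqrf_eq0 => /eqP.
move/eqP: yy; rewrite eqf_sqr => /orP[] /eqP yy.
  apply: Or32; split; first by rewrite yy.
  have y'0 : y' != 0 by rewrite -yy.
  by congr Quat; apply: (mulfI y'0); rewrite -?hb -?hc -?hd yy.
have y'0 : y' != 0 by rewrite -oppr_eq0 -yy.
apply: Or33; split; first by rewrite yy opprK.
have -> : - Quat 0 b c d = Quat (- 0) (- b) (- c) (- d) by [].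
by congr Quat; rewrite ?oppr0 //; apply: (mulfI y'0);
  rewrite -?hb -?hc -?hd yy mulNr mulrN.
Qed.

Definition conj_on (R : realType) (n : nat) (s : seq 'I_n) (z : 'rV[R[i]]_n) :
    'rV[R[i]]_n :=
  \row_l (if l \in s then conjc (z 0 l) else z 0 l).

Lemma conj_on_cons (R : realType) (n : nat) (h : 'I_n) (s : seq 'I_n)
    (z : 'rV[R[i]]_n) :
  h \notin s -> conj_on (h :: s) z = conj_at h (conj_on s z).
Proof.
move=> hs; apply/rowP => l; rewrite !mxE inE.
by case: eqP => [->|//] /=; rewrite (negPf hs).
Qed.

Lemma conj_onD (R : realType) (n : nat) (D : set 'rV[R[i]]_n) (s : seq 'I_n)
    (z : 'rV[R[i]]_n) :
  conj_invariant D -> uniq s -> D z -> D (conj_on s z).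
Proof.
move=> iD; elim: s => [_|h s IH /= /andP[hs us]] Dz.
  by congr (D _): Dz; apply/rowP => l; rewrite mxE.
by rewrite conj_on_cons //; apply: (proj1 (iD h _)); apply: IH.
Qed.

Lemma sign_card (R : realType) (n : nat) (K : {set 'I_n}) (h : 'I_n)
    (a : quat R) :
  (-1) ^+ #|K :&: [set h]%SET| * a = (if h \in K then -1 else 1 : R) *: a.
Proof.
case: ifPn => hK.
  have -> : (K :&: [set h] = [set h])%SET.
    by apply/finset.setIidPr; rewrite finset.sub1set.
  by rewrite cards1 expr1 mulN1r scaleN1r.
have -> : (K :&: [set h] = finset.set0)%SET.
  by apply/eqP; rewrite finset.setI_eq0 disjoint_sym disjoints1.
by rewrite cards0 expr0 mul1r scale1r.
Qed.

Lemma Stem_conj_on (R : realType) (n : nat) (e : {set 'I_n} -> 'rV[R]_(2 ^ n))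
    (D : set 'rV[R[i]]_n) (F : D -> 'rV[quat R]_(2 ^ n)) (K : {set 'I_n})
    (s : seq 'I_n) (z w : D) :
  conj_invariant D -> Stem e D F -> uniq s -> val w = conj_on s (val z) ->
  component e (F w) K =
    (\prod_(k <- s) (if k \in K then -1 else 1 : R)) *: component e (F z) K.
Proof.
move=> iD sF; elim: s w => [|h s IH] w.
  move=> _ ws; rewrite big_nil scale1r; congr (component e (F _) K).
  by apply/val_inj; rewrite /= ws; apply/rowP => l; rewrite mxE.
move=> /= /andP[hs us]; rewrite conj_on_cons // => ws.
pose u : D := SigSub (mem_set (conj_onD iD us (set_mem (valP z)))).
by rewrite (sF K h u w ws) sign_card (IH u us erefl) scalerA big_cons.
Qed.

Lemma Stem_real (R : realType) (n : nat) (e : {set 'I_n} -> 'rV[R]_(2 ^ n))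
    (D : set 'rV[R[i]]_n) (F : D -> 'rV[quat R]_(2 ^ n)) (K : {set 'I_n})
    (h : 'I_n) (z : D) :
  Stem e D F -> h \in K -> complex.Im (val z 0 h) = 0 -> component e (F z) K = 0.
Proof.
move=> sF hK z0.
have zz : val z = conj_at h (val z).
  apply/rowP => l; rewrite mxE; case: eqP => [->|//].
  by case: (val z 0 h) z0 => a b /= ->; rewrite oppr0.
have := sF K h z z zz; rewrite sign_card hK scaleN1r.
case: (component e (F z) K) => a b c d [].
have x0 (x : R) : x = - x -> x = 0.
  by move/eqP; rewrite -subr_eq0 opprK -mulr2n mulrn_eq0 => /eqP.
by move=> /x0 -> /x0 -> /x0 -> /x0 ->.
Qed.

Lemma slice_value_indep (R : realType) (n : nat)
    (e : {set 'I_n} -> 'rV[R]_(2 ^ n)) (D : set 'rV[R[i]]_n)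
    (F : D -> 'rV[quat R]_(2 ^ n)) (z w : D) (J L : 'rV[quat R]_n) :
  conj_invariant D -> Stem e D F -> sphere_tuples J -> sphere_tuples L ->
  slice_ptn (val z) J = slice_ptn (val w) L ->
  slice_value e J (F z) = slice_value e L (F w).
Proof.
move=> iD sF sJ sL zw; apply: eq_bigr => K _.
have zwl l : slice_pt (val z 0 l) (J 0 l) = slice_pt (val w 0 l) (L 0 l).
  by move/rowP: zw => /(_ l); rewrite !mxE.
have cases l := slice_pt_eq (sJ l) (sL l) (zwl l).
have [/existsP[h /andP[hK /eqP zh]]|] :=
    boolP [exists h, (h \in K) && (complex.Im (val z 0 h) == 0)].
  have wh : complex.Im (val w 0 h) = 0.
    case: (cases h) => [[<- //]|[<- //]|[-> _]].
    by case: (val z 0 h) zh => a b /= ->; rewrite oppr0.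
  by rewrite (Stem_real sF hK zh) (Stem_real sF hK wh) !mulr0.
move=> /existsPn nz.
pose S := [pred l | val w 0 l != val z 0 l].
have ws : val w = conj_on (enum S) (val z).
  apply/rowP => l; rewrite mxE mem_enum inE.
  by case: eqVneq => [->//|nwz]; case: (cases l) => [[E]|[E]|[]//];
    rewrite E eqxx in nwz.
rewrite (Stem_conj_on K iD sF (enum_uniq _) ws) big_enum_cond /=.
rewrite -scalerAr scalerAl; congr (_ * _).
have -> : \prod_(k in S | true) (if k \in K then -1 else 1 : R)
   = \prod_(k | k \in K) (if val w 0 k != val z 0 k then -1 else 1).
  by rewrite -!big_mkcondr /=; apply: eq_bigl => k; rewrite !inE !andbT andbC.
rewrite /ordered_prod -scaler_prod; apply: eq_bigr => k kK.
have {}nz : complex.Im (val z 0 k) != 0.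
  by have := nz k; rewrite negb_and kK.
case: (cases k) => [[_ E]|[-> ->]|[-> ->]].
- by rewrite E eqxx in nz.
- by rewrite eqxx scale1r.
- case: (val z 0 k) nz => a b /= nz; rewrite ifT ?scaleN1r ?opprK //.
  apply: contra nz => /eqP[] /eqP.
  by rewrite eq_sym -subr_eq0 opprK -mulr2n mulrn_eq0.
Qed.

Lemma slice_ofE (R : realType) (n : nat) (e : {set 'I_n} -> 'rV[R]_(2 ^ n))
    (D : set 'rV[R[i]]_n) (F : D -> 'rV[quat R]_(2 ^ n))
    (x : circularization D) (z : D) (J : 'rV[quat R]_n) :
  conj_invariant D -> Stem e D F -> sphere_tuples J ->
  val x = slice_ptn (val z) J -> slice_of e F x = slice_value e J (F z).
Proof.
move=> iD sF sJ xz; rewrite /slice_of; case: cid2 => -[w L] /= sL xw.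
by apply: slice_value_indep => //; rewrite xw.
Qed.

(* Main.v *)
Require Import Defs.
From mathcomp Require Import all_boot all_order all_algebra.
From mathcomp Require Import boolp classical_sets reals.
From mathcomp Require Import complex ring lra.

Set Implicit Arguments.
Unset Strict Implicit.
Unset Printing Implicit Defensive.

Import Order.TTheory GRing.Theory Num.Theory.
Local Open Scope classical_set_scope.
Local Open Scope ring_scope.

(** Why the theorem is true.  Write a point of the circularization as
    (z, J), with F_K the components of the stem function F, so that
    f(x) = sum_K J_K F_K(z).  If h lies in K, then
    J_K = J_P J_h J_Q with P, Q the elements of K below and above h.  When P
    is empty, the factor J_h comes first, and the term has the shape
    J_h * G2 of a one-variable slice function; the terms with h outside K
    supply G1.  Hence f is slice in x_h as soon as F_K = 0 whenever h is in K
    without being its minimum ([section_slice_of_vanish]).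

    Conversely, suppose that f is slice in x_h, and let L stand for J_h.
    Comparing the values at L and -L isolates the terms with h in K:
    their sum is L * G2 with G2 independent of L ([slice_sum_odd]).  The other
    units J_l are arbitrary, and changing the signs of some of them multiplies
    each term by a character of the group of sign changes; orthogonality of
    these characters ([sgn_inversion]) separates the terms, so for each single
    K containing h the quaternion L * (J_P L J_Q F_K) does not depend on L
    ([slice_sum_term]).  If F_K is not 0, then L J_P L is independent
    of the unit L, which forces J_P to be real ([sandwich_real]).  This cannot
    hold for all choices of J when P is nonempty: multiplying a nonzero
    quaternion by i and by j cannot give two real numbers
    ([mul_ij_real_eq0]).  So F_K = 0 ([slice_sum_vanish]).

    Imposing this for every h in H leaves exactly the K such that each element
    of H lying in K is the minimum of K ([leading]).  Such a K either avoids H or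
    meets it in its minimum only, which is how the sum in the statement is
    organised ([leading_sum]). *)

(** * Quaternions and imaginary units *)

Definition conjq (R : realType) (p : quat R) : quat R :=
  Quat (qre p) (- qi p) (- qj p) (- qk p).

Lemma mul_conjq (R : realType) (p : quat R) :
  conjq p * p = (qre p ^+ 2 + qi p ^+ 2 + qj p ^+ 2 + qk p ^+ 2)%:A.
Proof. by case: p => a b c d; congr Quat => /=; ring. Qed.

(** The quaternions have no zero divisors, since conjq p * p is |p|^2. *)
Lemma mulq_eq0 (R : realType) (p q : quat R) : p * q = 0 -> p = 0 \/ q = 0.
Proof.
move=> pq; have := congr1 (fun x => conjq p * x) pq.
rewrite mulr0 mulrA mul_conjq -scalerAl mul1r => /eqP.
rewrite scaler_eq0 => /orP[|/eqP]; last by right.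
case: p {pq} => a b c d /= s0; left.
have a0 := sqr_ge0 a; have b0 := sqr_ge0 b.
have c0 := sqr_ge0 c; have d0 := sqr_ge0 d.
move: s0; rewrite !paddr_eq0 ?addr_ge0 // !sqrf_eq0.
by move=> /andP[/andP[/andP[/eqP-> /eqP->] /eqP->] /eqP->].
Qed.

Lemma sphereN (R : realType) (J : quat R) : sphere J -> sphere (- J).
Proof. by rewrite /sphere /= sqrrN. Qed.

Lemma sphere_mul (R : realType) (J : quat R) : sphere J -> J * J = -1.
Proof. by rewrite /sphere /= expr2. Qed.

Lemma sphere_neq0 (R : realType) (J : quat R) : sphere J -> J <> 0.
Proof.
by move=> /sphere_mul E J0; move/eqP: E; rewrite J0 mul0r eq_sym oppr_eq0 oner_eq0.
Qed.

Definition quat_i (R : realType) : quat R := Quat 0 1 0 0.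
Definition quat_j (R : realType) : quat R := Quat 0 0 1 0.
Definition quat_k (R : realType) : quat R := Quat 0 0 0 1.

Lemma sphere_i (R : realType) : sphere (quat_i R).
Proof. by rewrite /sphere /= expr2; congr Quat => /=; ring. Qed.

Lemma sphere_j (R : realType) : sphere (quat_j R).
Proof. by rewrite /sphere /= expr2; congr Quat => /=; ring. Qed.

Lemma sphere_k (R : realType) : sphere (quat_k R).
Proof. by rewrite /sphere /= expr2; congr Quat => /=; ring. Qed.

(** If p = a + v with v imaginary, then L p L = - a + L v L, and L v L is
    v or - v according as L is orthogonal or parallel to v.  It suffices
    to compare the three basic units. *)
Lemma sandwich_real (R : realType) (p : quat R) :
  (forall L L' : quat R, sphere L -> sphere L' -> L * p * L = L' * p * L') ->
  [/\ qi p = 0, qj p = 0 & qk p = 0].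
Proof.
move=> E; have := E _ _ (sphere_i R) (sphere_j R).
have := E _ _ (sphere_i R) (sphere_k R).
by case: p {E} => a b c d [????] [????] /=; split; lra.
Qed.

(** The real multiples of i and those of j meet only in 0. *)
Lemma mul_ij_real_eq0 (R : realType) (c : quat R) :
  [/\ qi (quat_i R * c) = 0, qj (quat_i R * c) = 0 & qk (quat_i R * c) = 0] ->
  [/\ qi (quat_j R * c) = 0, qj (quat_j R * c) = 0 & qk (quat_j R * c) = 0] ->
  c = 0.
Proof.
case: c => a b c d [/= ???] [/= ???].
by have -> : (0 : quat R) = Quat 0 0 0 0 by []; congr Quat; lra.
Qed.

(** * Ordered products of imaginary units *)

(** The coordinates are points of the complex plane as well as quaternions,
    hence the arbitrary type. *)
Definition subst_coord (T : Type) (n : nat) (h : 'I_n) (v : 'rV[T]_n) (x : T) :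
    'rV[T]_n :=
  \row_l (if l == h then x else v 0 l).

Lemma sphere_subst (R : realType) (n : nat) (h : 'I_n) (J : 'rV[quat R]_n)
    (L : quat R) :
  sphere_tuples J -> sphere L -> sphere_tuples (subst_coord h J L).
Proof. by move=> sJ sL l; rewrite mxE; case: eqP. Qed.

(** The ring is not commutative, so splitting a product over a union requires
    all factors indexed by P to precede those indexed by Q. *)
Lemma big_ltn_union (R : pzSemiRingType) (n : nat) (s : seq 'I_n) (F : 'I_n -> R)
    (P Q : {set 'I_n}) :
  pairwise (relpre val ltn) s ->
  (forall p q, p \in P -> q \in Q -> (p < q)%N) ->
  \prod_(k <- s | k \in (P :|: Q)%SET) F k =
  \prod_(k <- s | k \in P) F k * \prod_(k <- s | k \in Q) F k.
Proof.
move=> + PQ; elim: s => [|k s IH] /=; first by rewrite !big_nil mulr1.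
move=> /andP[/allP ks /IH E]; rewrite !big_cons finset.in_setU {}E.
case: (boolP (k \in P)) => kP /=.
  by rewrite ifF ?mulrA //; apply/negP => /(PQ _ _ kP); rewrite ltnn.
case: ifP => // kQ.
have -> : \prod_(l <- s | l \in P) F l = 1; last by rewrite !mul1r.
apply: big1_seq => l /andP[lP /ks /= kl].
by have := ltn_trans kl (PQ _ _ lP kQ); rewrite ltnn.
Qed.

Section OrderedProduct.
Variables (R : realType) (n : nat).
Implicit Types (J q : 'rV[quat R]_n) (K P Q : {set 'I_n}) (h : 'I_n).

Lemma ordered_prodU q P Q :
  (forall k l, k \in P -> l \in Q -> (k < l)%N) ->
  ordered_prod q (P :|: Q)%SET = ordered_prod q P * ordered_prod q Q.
Proof.
move=> PQ; apply: big_ltn_union => //.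
rewrite -sorted_pairwise; last by move=> y x z; exact: ltn_trans.
rewrite -(sorted_map (f := val)) -[index_enum _]/(Finite.enum _) -enumT val_enum_ord.
exact: iota_ltn_sorted.
Qed.

Lemma ordered_prod1 q h : ordered_prod q [set h]%SET = q 0 h.
Proof.
by rewrite /ordered_prod (eq_bigl (pred1 h)) ?big_pred1_eq // => k; rewrite inE.
Qed.

Lemma ordered_prod_subst h q L K :
  h \notin K -> ordered_prod (subst_coord h q L) K = ordered_prod q K.
Proof.
move=> hK; apply: eq_bigr => k kK; rewrite mxE.
by case: eqP => // kh; rewrite -kh kK in hK.
Qed.

Lemma ordered_prod_subst_min h q L K :
  h \in K -> (forall k, k \in K -> (h <= k)%N) ->
  ordered_prod (subst_coord h q L) K = L * ordered_prod q (K :\ h)%SET.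
Proof.
move=> hK hmin; rewrite -{1}(finset.setD1K hK) ordered_prodU; last first.
  move=> k l; rewrite !inE => /eqP -> /andP[lh /hmin hl].
  by rewrite ltn_neqAle hl andbT eq_sym.
by rewrite ordered_prod1 mxE eqxx ordered_prod_subst // !inE eqxx.
Qed.

Lemma ordered_prod_neq0 J K : sphere_tuples J -> ordered_prod J K <> 0.
Proof.
move=> sJ; rewrite /ordered_prod; elim/big_ind: _.
- by move/eqP; rewrite oner_eq0.
- by move=> p q p0 q0 /mulq_eq0[].
- by move=> k _; apply: sphere_neq0.
Qed.

(** * Sign changes and separation of the terms *)

Definition sgn_at (S : {set 'I_n}) (k : 'I_n) : R := if k \in S then -1 else 1.

Definition flip (S : {set 'I_n}) q : 'rV[quat R]_n :=
  \row_l (sgn_at S l *: q 0 l).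

Lemma sphere_sgn S k (L : quat R) : sphere L -> sphere (sgn_at S k *: L).
Proof.
by rewrite /sgn_at; case: ifP; rewrite ?scale1r ?scaleN1r // => _; exact: sphereN.
Qed.

Lemma ordered_prod_flip S q K :
  ordered_prod (flip S q) K =
  (\prod_(k | k \in K) sgn_at S k) *: ordered_prod q K.
Proof.
by rewrite /ordered_prod -scaler_prod; apply: eq_bigr => k _; rewrite mxE.
Qed.

(** The functions S |-> prod_(k in K) sgn_at S k are the characters of the
    group of sign changes of n coordinates; they are orthogonal, hence
    linearly independent over any vector space of coefficients. *)
Lemma sgn_inversion (V : lmodType R) (a : {set 'I_n} -> V) :
  (forall S : {set 'I_n},
     \sum_(K : {set 'I_n}) (\prod_(k | k \in K) sgn_at S k) *: a K = 0) ->
  forall K, a K = 0.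
Proof.
move=> a0 K.
have swap (S L : {set 'I_n}) :
    \prod_(k | k \in L) sgn_at S k = \prod_(k | k \in S) sgn_at L k.
  rewrite big_mkcond [RHS]big_mkcond; apply: eq_bigr => k _.
  by rewrite /sgn_at; do 2!case: ifP.
(* sum_S prod_(k in S) x_k = prod_k (x_k + 1), where x_k is the product of the
   two signs: a factor vanishes as soon as K and L differ at k. *)
have ortho (L : {set 'I_n}) : \sum_(S : {set 'I_n})
    (\prod_(k | k \in K) sgn_at S k) * (\prod_(k | k \in L) sgn_at S k)
    = \prod_(k < n) (sgn_at K k * sgn_at L k + 1).
  rewrite bigA_distr; apply: eq_bigr => S _.
  rewrite !(swap S) -big_split big_mkcond; apply: eq_bigr => k _ //.
have : \sum_(S : {set 'I_n}) (\prod_(k | k \in K) sgn_at S k) *: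
    (\sum_(L : {set 'I_n}) (\prod_(k | k \in L) sgn_at S k) *: a L) = 0.
  by rewrite big1 // => S _; rewrite a0 scaler0.
under eq_bigr do rewrite scaler_sumr.
rewrite exchange_big /=.
under eq_bigr => L _.
  under eq_bigr do rewrite scalerA.
  rewrite -scaler_suml ortho; over.
rewrite (bigD1 K) //= [X in _ + X]big1 ?addr0.
  move/eqP; rewrite scaler_eq0 => /orP[|/eqP //]; rewrite prodf_seq_eq0.
  move=> /hasP[k _]; rewrite -expr2 /sgn_at.
  by case: ifP => _; rewrite ?sqrrN expr1n -mulr2n pnatr_eq0.
move=> /= L LK.
have [k kLK] : exists k, (k \in K) != (k \in L).
  apply/existsP; apply: contraNT LK => /existsPn KL; apply/eqP/finset.setP => k.
  by have := KL k; rewrite negbK => /eqP.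
rewrite (bigD1 k) //=.
have -> : sgn_at K k * sgn_at L k + 1 = 0.
  by move: kLK; rewrite /sgn_at; do 2!case: ifP => _ //=; move=> _; ring.
by rewrite mul0r scale0r.
Qed.

Lemma flip_subst S h J L :
  flip S (subst_coord h J L) = subst_coord h (flip S J) (sgn_at S h *: L).
Proof. by apply/rowP => l; rewrite !mxE; case: eqP => // ->. Qed.

Lemma sphere_flip S J : sphere_tuples J -> sphere_tuples (flip S J).
Proof. by move=> sJ l; rewrite mxE; exact: sphere_sgn. Qed.

(** Replacing L by - L changes the sign of the terms with h in K only,
    so these sum up to half the difference of the two values. *)
Lemma slice_sum_odd (a : {set 'I_n} -> quat R) h J (G1 G2 : quat R) :
  (forall L, sphere L ->
     \sum_(K : {set 'I_n}) ordered_prod (subst_coord h J L) K * a K =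
     G1 + L * G2) ->
  forall L, sphere L ->
    \sum_(K : {set 'I_n} | h \in K) ordered_prod (subst_coord h J L) K * a K
    = L * G2.
Proof.
move=> E L sL; have Ep := E _ sL; have En := E _ (sphereN sL).
have two : (2 : R) != 0 by rewrite pnatr_eq0.
apply: (scalerI two); rewrite !scaler_nat.
rewrite (_ : L * G2 *+ 2 = (G1 + L * G2) - (G1 + - L * G2)); last first.
  by rewrite mulNr opprD opprK addrACA subrr add0r mulr2n.
rewrite -Ep -En -sumrB -sumrMnl big_mkcond; apply: eq_bigr => K _.
have -> : subst_coord h J (- L) = flip [set h]%SET (subst_coord h J L).
  apply/rowP => l; rewrite !mxE /sgn_at inE.
  by case: eqP => _; rewrite ?scaleN1r ?scale1r.
rewrite ordered_prod_flip; case: ifP => hK.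
  rewrite (bigD1 h) //= big1 ?mulr1 /sgn_at ?inE ?eqxx.
    by rewrite scaleN1r mulNr opprK -mulr2n.
  by move=> k /andP[_ kh]; rewrite inE (negPf kh).
rewrite big1 ?scale1r ?subrr // => k kK; rewrite /sgn_at inE.
by case: eqP => // kh; rewrite -kh kK in hK.
Qed.

(** Multiplying by L on the left removes the factor L in the conclusion of
    [slice_sum_odd], up to the sign L ^ 2 = -1, and makes both sides comparable
    for different units.  Each choice of signs S gives one equation between the
    terms, and [sgn_inversion] solves the resulting system. *)
Lemma slice_sum_term (a : {set 'I_n} -> quat R) h :
  (forall J, sphere_tuples J -> exists G1 G2 : quat R, forall L, sphere L ->
     \sum_(K : {set 'I_n}) ordered_prod (subst_coord h J L) K * a K =
     G1 + L * G2) ->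
  forall J K L L', sphere_tuples J -> h \in K -> sphere L -> sphere L' ->
    L * (ordered_prod (subst_coord h J L) K * a K) =
    L' * (ordered_prod (subst_coord h J L') K * a K).
Proof.
move=> E J K0 L L' sJ hK0 sL sL'.
pose c M (K : {set 'I_n}) : quat R :=
  if h \in K then M * (ordered_prod (subst_coord h J M) K * a K) else 0.
suff /(_ K0) : forall K, c L K - c L' K = 0.
  by rewrite /c hK0 => /eqP; rewrite subr_eq0 => /eqP.
apply: sgn_inversion => S.
have [G1 [G2 /slice_sum_odd EG]] := E _ (sphere_flip S sJ).
(* The sign at h cannot be dropped from the character of K; it is absorbed in
   the unit, by taking sgn_at S h *: M at the coordinate h. *)
have cS M : sphere M ->
    \sum_(K : {set 'I_n}) (\prod_(k | k \in K) sgn_at S k) *: c M K =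
    - (sgn_at S h *: G2).
  move=> sM; have := EG _ (sphere_sgn S h sM).
  rewrite -flip_subst => /(congr1 (fun x => M * x)).
  rewrite -scalerAl -scalerAr mulrA sphere_mul // mulN1r scalerN => <-.
  rewrite mulr_sumr [RHS]big_mkcond; apply: eq_bigr => K _.
  rewrite /c; case: ifP => _; last by rewrite scaler0.
  by rewrite ordered_prod_flip -scalerAl -scalerAr.
under eq_bigr do rewrite scalerBr.
by rewrite sumrB !cS // subrr.
Qed.

Lemma split_at h K : h \in K ->
  K = ((K :&: [set k : 'I_n | (k < h)%N]) :|: [set h]
       :|: (K :&: [set k : 'I_n | (h < k)%N]))%SET.
Proof.
move=> hK; apply/finset.setP => k; rewrite !inE -val_eqE /=.
by case: ltngtP => [_|_|/val_inj ->]; rewrite ?hK ?andbT ?andbF ?orbF.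
Qed.

Lemma ordered_prod_split q h P Q :
  (forall k, k \in P -> (k < h)%N) -> (forall k, k \in Q -> (h < k)%N) ->
  ordered_prod q (P :|: [set h] :|: Q)%SET =
  ordered_prod q P * q 0 h * ordered_prod q Q.
Proof.
move=> Ph hQ; rewrite ordered_prodU; last first.
  move=> k l; rewrite !inE => /orP[/Ph kh|/eqP ->] /hQ //.
  exact: ltn_trans.
rewrite ordered_prodU ?ordered_prod1 // => k l /Ph kh.
by rewrite inE => /eqP ->.
Qed.

(** The algebraic heart of the theorem: a sum over K that is slice in the
    unit at h, for all values of the other units, has no term in which some
    factor precedes the one at h. *)
Lemma slice_sum_vanish (a : {set 'I_n} -> quat R) h :
  (forall J, sphere_tuples J -> exists G1 G2 : quat R, forall L, sphere L ->
     \sum_(K : {set 'I_n}) ordered_prod (subst_coord h J L) K * a K =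
     G1 + L * G2) ->
  forall K p, h \in K -> p \in K -> (p < h)%N -> a K = 0.
Proof.
move=> E K p1 hK p1K p1h; apply: contrapT => aK.
set P := (K :&: [set k : 'I_n | (k < h)%N])%SET.
set Q := (K :&: [set k : 'I_n | (h < k)%N])%SET.
have Ph k : k \in P -> (k < h)%N by rewrite !inE => /andP[].
have hQ k : k \in Q -> (h < k)%N by rewrite !inE => /andP[].
have PQ : K = (P :|: [set h] :|: Q)%SET := split_at hK.
have realP J : sphere_tuples J -> let p := ordered_prod J P in
    [/\ qi p = 0, qj p = 0 & qk p = 0].
  move=> sJ p; apply: sandwich_real => L L' sL sL'.
  have := slice_sum_term E sJ hK sL sL'.
  have valE M : ordered_prod (subst_coord h J M) K =
      p * M * ordered_prod J Q.
    rewrite {1}PQ ordered_prod_split // mxE eqxx !ordered_prod_subst //.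
      by apply/negP => /hQ; rewrite ltnn.
    by apply/negP => /Ph; rewrite ltnn.
  rewrite !valE => /eqP; rewrite !mulrA -subr_eq0 -!mulrBl -mulrA => /eqP.
  move=> /mulq_eq0[/eqP|/mulq_eq0[/ordered_prod_neq0|]] //.
  by rewrite subr_eq0 => /eqP.
have p1P : p1 \in P by rewrite !inE p1K.
(* Only the first unit of P varies, and it multiplies the rest of the product
   on the left: the values i and j at the minimum are enough. *)
pose m := [arg min_(k < p1 in P) val k].
have [mP mmin] : m \in P /\ forall k, k \in P -> (m <= k)%N.
  by rewrite /m; case: arg_minnP.
pose J0 : 'rV[quat R]_n := const_mx (quat_i R).
have sJ0 : sphere_tuples J0 by move=> l; rewrite mxE; exact: sphere_i.
apply: (ordered_prod_neq0 (K := P :\ m)%SET sJ0).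
have Pm M : ordered_prod (subst_coord m J0 M) P = M * ordered_prod J0 (P :\ m)%SET.
  exact: ordered_prod_subst_min.
apply: mul_ij_real_eq0; rewrite -Pm; apply: realP; apply: sphere_subst => //.
  exact: sphere_i.
exact: sphere_j.
Qed.

End OrderedProduct.

(** * One-variable sections *)

Section Sections.
Variables (R : realType) (n : nat) (e : {set 'I_n} -> 'rV[R]_(2 ^ n)).
Variables (D : set 'rV[R[i]]_n) (hD : conj_invariant D).
Implicit Types (F : D -> 'rV[quat R]_(2 ^ n)) (J : 'rV[quat R]_n) (h : 'I_n).

Definition fiber h (z : 'rV[R[i]]_n) : set R[i] :=
  [set w | D (subst_coord h z w)].

Definition fiber_pt h (z : 'rV[R[i]]_n) (w : fiber h z) : D :=
  SigSub (mem_set (set_mem (valP w) : D (subst_coord h z (val w)))).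

Lemma fiber_conj h z : conj_invariant1 (fiber h z).
Proof.
move=> w; rewrite /fiber /=.
have -> : subst_coord h z (conjc w) = conj_at h (subst_coord h z w).
  by apply/rowP => l; rewrite !mxE; case: eqP.
exact: hD.
Qed.

Lemma slice_ptn_subst h z J (w : R[i]) (L : quat R) :
  slice_ptn (subst_coord h z w) (subst_coord h J L) =
  subst_at h (slice_ptn z J) (slice_pt w L).
Proof. by apply/rowP => l; rewrite !mxE; case: eqP. Qed.

Lemma circularization_ptn z J :
  D z -> sphere_tuples J -> circularization D (slice_ptn z J).
Proof.
by move=> Dz sJ; exists (SigSub (mem_set Dz) : D, J).
Qed.

(** Two representations of the same quaternion have the same or conjugate
    complex parts, so a representation of a point of the section differs
    from z off h only by conjugations, under which D is invariant. *)
Lemma section_domE h z J : sphere_tuples J ->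
  section_dom D h (slice_ptn z J) = circularization1 (fiber h z).
Proof.
move=> sJ; apply/seteqP; split => x /=; last first.
  move=> [w [L [Dw sL ->]]]; rewrite /section_dom /= -slice_ptn_subst.
  by apply: circularization_ptn => //; exact: sphere_subst.
move=> [[z' J'] /= sJ' /rowP E].
exists (val z' 0 h), (J' 0 h); split => //; last first.
  by have := E h; rewrite !mxE eqxx.
rewrite /fiber /=.
pose S := [pred l | subst_coord h z (val z' 0 h) 0 l != val z' 0 l].
have -> : subst_coord h z (val z' 0 h) = conj_on (enum S) (val z').
  apply/rowP => l; rewrite [RHS]mxE mem_enum [l \in S]inE /=.
  have [//|/eqP] := eqVneq (subst_coord h z (val z' 0 h) 0 l) (val z' 0 l).
  rewrite mxE; case: (eqVneq l h) => [-> //|lh] /= zl.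
  have := E l; rewrite !mxE (negPf lh).
  by move=> /(slice_pt_eq (sJ' l) (sJ l))[[]|[]|[-> _]] // zz; case: zl.
apply: conj_onD => //; first exact: enum_uniq.
exact: set_mem (valP z').
Qed.

Lemma section_funE F h z J (sJ : sphere_tuples J) (w : fiber h z) (L : quat R)
    (x : section_dom D h (slice_ptn z J)) :
  Stem e D F -> sphere L -> val x = slice_pt (val w) L ->
  section_fun (slice_of e F) x =
  \sum_(K : {set 'I_n})
    ordered_prod (subst_coord h J L) K * component e (F (fiber_pt w)) K.
Proof.
move=> sF sL xw; rewrite /section_fun.
by apply: slice_ofE => //=; [exact: sphere_subst | rewrite xw slice_ptn_subst].
Qed.

(** Where no factor precedes the one at h, the unit J_h can be taken out on the
    left.  The parity of F_K at the coordinate h makes the coefficients G1 and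
    G2 even and odd under conjugation. *)
Lemma section_slice_of_vanish F h : Stem e D F ->
  (forall (K : {set 'I_n}) p z, h \in K -> p \in K -> (p < h)%N ->
     component e (F z) K = 0) ->
  forall y : circularization D,
    slice1 (section_fun (h := h) (y := val y) (slice_of e F)).
Proof.
move=> sF F0 [y /set_mem y0] /=; case: (y0) => -[z J] /= sJ yE; subst y.
exists (fiber h (val z)); split; [exact: fiber_conj|exact: section_domE|].
exists (fun w => \sum_(K : {set 'I_n} | h \notin K)
  ordered_prod J K * component e (F (fiber_pt w)) K).
exists (fun w => \sum_(K : {set 'I_n} | h \in K)
  ordered_prod J (K :\ h)%SET * component e (F (fiber_pt w)) K).
split=> [v w vw|w L x sL xw].
  have FE K : component e (F (fiber_pt w)) K =
      (if h \in K then -1 else 1 : R) *: component e (F (fiber_pt v)) K.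
    rewrite -sign_card; apply: sF; rewrite /= vw.
    by apply/rowP => l; rewrite !mxE; case: eqP.
  split; first by apply: eq_bigr => K /negPf hK; rewrite FE hK scale1r.
  by rewrite -sumrN; apply: eq_bigr => K hK; rewrite FE hK scaleN1r mulrN.
rewrite (section_funE sJ sF sL xw).
rewrite (bigID (fun K : {set 'I_n} => h \in K)) /= addrC.
congr (_ + _); first by apply: eq_bigr => K hK; rewrite ordered_prod_subst.
rewrite mulr_sumr; apply: eq_bigr => K hK.
have [/existsP[p /andP[pK ph]]|/existsPn Kh] :=
  boolP [exists p, (p \in K) && (p < h)%N].
  by rewrite (F0 K p) // !mulr0.
rewrite mulrA ordered_prod_subst_min // => k kK.
by rewrite leqNgt; have := Kh k; rewrite kK.
Qed.

(** Fix z and let only the units vary: every tuple J over z gives a point of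
    the circularization, and the section through it yields the hypothesis of
    [slice_sum_vanish]. *)
Lemma vanish_of_section_slice F h : Stem e D F ->
  (forall y : circularization D,
    slice1 (section_fun (h := h) (y := val y) (slice_of e F))) ->
  forall (K : {set 'I_n}) p z, h \in K -> p \in K -> (p < h)%N ->
    component e (F z) K = 0.
Proof.
move=> sF sl K p z hK pK ph.
apply: (slice_sum_vanish (a := component e (F z)) _ hK pK ph) => J sJ.
have Dz : D (val z) := set_mem (valP z).
have [E [cE UE [G1 [G2 [_ GE]]]]] :=
  sl (SigSub (mem_set (circularization_ptn Dz sJ))).
pose w := val z 0 h.
have zw : subst_coord h (val z) w = val z.
  by apply/rowP => l; rewrite mxE; case: eqP => // ->.
have fw : fiber h (val z) w by rewrite /fiber /= zw.
have fE : fiber_pt (SigSub (mem_set fw)) = z by apply: val_inj.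
have Uw L : sphere L -> section_dom D h (slice_ptn (val z) J) (slice_pt w L).
  by move=> sL; rewrite section_domE //; exists w, L.
(* E is only known through its circularization, which puts either w or its
   conjugate in E; both are then in E by invariance. *)
have Ew : E w.
  have := Uw _ (sphere_i R); rewrite [section_dom _ _ _]UE => -[w' [L' [Ew' sL']]].
  move=> /(slice_pt_eq (sphere_i R) sL')[[->]|[->]|[ww' _]] //.
  by apply/cE; rewrite -ww'.
exists (G1 (SigSub (mem_set Ew))), (G2 (SigSub (mem_set Ew))) => L sL.
rewrite -(GE _ _ (SigSub (mem_set (Uw L sL))) sL) //=.
by rewrite (section_funE sJ (w := SigSub (mem_set fw)) sF sL) ?fE.
Qed.

Lemma SliceInSetP F (H : {set 'I_n}) : Stem e D F ->
  SliceInSet e D H (slice_of e F) <->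
  forall h (K : {set 'I_n}) p z, h \in H -> h \in K -> p \in K -> (p < h)%N ->
    component e (F z) K = 0.
Proof.
move=> sF; split=> [[_ fH] h K p z hH|F0].
  by have [_] := fH h hH; move=> /(vanish_of_section_slice sF); exact.
split=> [|h hH]; first by exists F.
split; first by exists F.
by apply: section_slice_of_vanish => // K p z; exact: F0.
Qed.

End Sections.

(** * Stem functions supported on a family of index sets *)

Section Components.
Variables (R : realType) (n : nat) (e : {set 'I_n} -> 'rV[R]_(2 ^ n)).
Hypothesis he : is_basis e.
Implicit Types (h : 'I_n) (H K Q : {set 'I_n}).

Lemma partial_tens_sumP (A : pred {set 'I_n}) (t : 'rV[quat R]_(2 ^ n)) :
  t = \sum_(K | A K) tens (e K) (component e t K) <->
  forall K, ~~ A K -> component e t K = 0.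
Proof.
have tens0 K : tens (e K) (0 : quat R) = 0.
  by apply/rowP => j; rewrite !mxE scaler0.
split=> [tE K AK|t0].
  rewrite tE big_mkcond.
  under eq_bigr => L _.
    rewrite (_ : (if A L then _ else _) =
      tens (e L) (if A L then component e t L else 0)); first over.
    by case: ifP => // _; rewrite tens0.
  by rewrite component_sum_tens // (negPf AK).
rewrite [RHS]big_mkcond -[LHS](tens_component t he); apply: eq_bigr => K _.
by case: ifPn => // /t0 ->; rewrite tens0.
Qed.

(** The index sets K that survive: each element of H lying in K is the
    minimum of K. *)
Definition leading H K : bool :=
  [forall h in H, (h \in K) ==> [forall k in K, (h <= k)%N]].

Lemma leadingPn H K :
  reflect (exists h p, [/\ h \in H, h \in K, p \in K & (p < h)%N])
    (~~ leading H K).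
Proof.
apply: (iffP idP).
  rewrite negb_forall => /existsP[h]; rewrite !negb_imply => /and3P[hH hK].
  rewrite negb_forall => /existsP[p]; rewrite negb_imply -ltnNge => /andP[pK ph].
  by exists h, p.
move=> [h [p [hH hK pK ph]]]; rewrite negb_forall; apply/existsP; exists h.
rewrite !negb_imply hH hK negb_forall; apply/existsP; exists p.
by rewrite negb_imply pK -ltnNge.
Qed.

(** A leading K avoids H, or meets it in a single element h, its minimum; in
    the second case it is h |: Q for a unique Q above h and outside H. *)
Lemma leading_sum (V : nmodType) (G : {set 'I_n} -> V) H :
  \sum_(K | leading H K) G K =
  \sum_(K : {set 'I_n} | K \subset (~: H)%SET) G K +
  \sum_(h in H) \sum_(Q : {set 'I_n} |
      Q \subset ([set k : 'I_n | (h < k)%N] :\: H)%SET) G (h |: Q)%SET.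
Proof.
pose c h (K : {set 'I_n}) := (h \in K) &&
  ((K :\ h)%SET \subset ([set k : 'I_n | (h < k)%N] :\: H)%SET).
have leadingE K : leading H K -> forall h, h \in H -> h \in K ->
    forall k, k \in K -> (h <= k)%N.
  move=> LK h hH hK k kK; move/forall_inP: LK => /(_ h hH)/implyP/(_ hK).
  by move/forall_inP; exact.
have cE h K : h \in H -> c h K = (h \in K) && leading H K.
  move=> hH; rewrite /c; case: (boolP (h \in K)) => //= hK; apply/idP/idP.
    move=> /fintype.subsetP KH; apply/negPn/negP.
    move=> /leadingPn[h' [p [h'H h'K pK ph']]].
    have [E|h'h] := eqVneq h' h; last first.
      by have := KH h'; rewrite !inE h'h h'K h'H => /(_ isT).
    have := KH p; rewrite !inE pK -E; case: eqP => [pE|_ /(_ isT)].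
      by rewrite pE ltnn in ph'.
    by move=> /andP[_ /(ltn_trans ph')]; rewrite ltnn.
  move=> /leadingE LK; apply/fintype.subsetP => k; rewrite !inE => /andP[kh kK].
  have hk := LK h hH hK k kK.
  rewrite ltn_neqAle hk andbT eq_sym -[_ != _]/(k != h) kh andbT.
  apply/negP => kH; case/eqP: kh; apply: val_inj; apply/eqP.
  by rewrite eqn_leq hk andbT (LK k kH kK).
rewrite (bigID (fun K : {set 'I_n} => K \subset (~: H)%SET)) /=; congr (_ + _).
  apply: eq_bigl => K; rewrite andb_idl // => /fintype.subsetP KH.
  apply/negPn/negP => /leadingPn[h [p [hH /KH]]].
  by rewrite inE hH.
transitivity (\sum_(h in H) \sum_(K | c h K) G K); last first.
  apply: eq_bigr => h hH.
  rewrite (reindex_onto (fun Q => h |: Q)%SET (fun K => K :\ h)%SET).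
    apply: eq_bigl => Q; rewrite /c finset.setU11 /=.
    apply/andP/idP => [[QH /eqP QE]|QH]; first by rewrite -QE.
    have hQ : h \notin Q.
      by apply/negP => /(fintype.subsetP QH); rewrite !inE ltnn andbF.
    by rewrite finset.setU1K ?eqxx.
  by move=> K /andP[hK _]; rewrite finset.setD1K.
rewrite (exchange_big_dep xpredT) //= big_mkcond; apply: eq_bigr => K _.
rewrite (eq_bigl (fun h => (h \in H) && (h \in K) && leading H K)); last first.
  by move=> h /=; case: (boolP (h \in H)) => //= hH; rewrite cE.
case: (boolP (leading H K)) => LK /=; last first.
  by rewrite big_pred0 // => h; rewrite andbF.
case: ifPn => KH; last first.
  rewrite big_pred0 // => h; rewrite andbT; apply/negP => /andP[hH hK].
  by move: KH; rewrite negbK => /fintype.subsetP/(_ h hK); rewrite inE hH.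
have /fintype.subsetPn[h hK] := KH; rewrite inE negbK => hH.
rewrite (big_pred1 h) // => k; rewrite andbT /=.
apply/andP/eqP => [[kH kK]|-> //]; apply: val_inj; apply/eqP.
by rewrite eqn_leq (leadingE K LK k) // (leadingE K LK h).
Qed.

End Components.

(** * The characterization *)

Lemma SliceInSet_image (R : realType) (n : nat)
    (e : {set 'I_n} -> 'rV[R]_(2 ^ n)) (D : set 'rV[R[i]]_n) (H : {set 'I_n}) :
  is_basis e -> conj_invariant D ->
  SliceInSet e D H =
  [set slice_of e F | F in
    [set F : D -> 'rV[quat R]_(2 ^ n) | Stem e D F /\
       F = (fun z : D =>
         \sum_(K : {set 'I_n} | K \subset ~: H)
           tens (e K) (component e (F z) K)
         + \sum_(h in H)
             \sum_(Q : {set 'I_n} |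
                   Q \subset ([set k : 'I_n | (h < k)%N] :\: H)%SET)
               tens (e (h |: Q)%SET) (component e (F z) (h |: Q)%SET))]].
Proof.
move=> he hD; apply/seteqP; split=> f.
  move=> fH; case: (fH) => -[F sF fE] _; exists F => //; split=> //.
  apply/funext => z; rewrite -(leading_sum (fun K => tens _ (component e (F z) K))).
  apply/(partial_tens_sumP he) => K /leadingPn[h [p [hH hK pK ph]]].
  by move: fH; rewrite -fE => /(SliceInSetP hD H sF)/(_ h K p z); exact.
move=> [F [sF FE] <-]; apply/(SliceInSetP hD H sF) => h K p z hH hK pK ph.
have /(partial_tens_sumP he) : F z =
    \sum_(K | leading H K) tens (e K) (component e (F z) K).
  by rewrite leading_sum {1}FE.
by apply; apply/leadingPn; exists h, p.
Qed.

Theorem proposition3p1 (R : realType) (n : nat) (hn : (0 < n)%N)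
    (e : {set 'I_n} -> 'rV[R]_(2 ^ n)) (he : is_basis e)
    (D : set 'rV[R[i]]_n) (hD : conj_invariant D) :
  (forall H : {set 'I_n},
     SliceInSet e D H =
     [set slice_of e F | F in
       [set F : D -> 'rV[quat R]_(2 ^ n) | Stem e D F /\
          F = (fun z : D =>
            \sum_(K : {set 'I_n} | K \subset ~: H)
              tens (e K) (component e (F z) K)
            + \sum_(h in H)
                \sum_(Q : {set 'I_n} |
                      Q \subset ([set k : 'I_n | (h < k)%N] :\: H)%SET)
                  tens (e (h |: Q)%SET) (component e (F z) (h |: Q)%SET))]])
  /\
  (forall h : 'I_n,
     SliceIn e D h =
     [set slice_of e F | F in
       [set F : D -> 'rV[quat R]_(2 ^ n) | Stem e D F /\
          F = (fun z : D =>
            \sum_(K : {set 'I_n} | h \notin K)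
              tens (e K) (component e (F z) K)
            + \sum_(Q : {set 'I_n} |
                    Q \subset ([set k : 'I_n | (h < k)%N])%SET)
                tens (e (h |: Q)%SET) (component e (F z) (h |: Q)%SET))]])
  /\
  (forall (H : {set 'I_n}) (F : D -> 'rV[quat R]_(2 ^ n)), Stem e D F ->
     (SliceInSet e D H (slice_of e F) <->
      forall (h : 'I_n) (Q P : {set 'I_n}),
        h \in H ->
        Q \subset ([set k : 'I_n | (h < k)%N])%SET ->
        P \subset ([set k : 'I_n | (k < h)%N])%SET ->
        P <> finset.set0 ->
        forall z : D, component e (F z) (P :|: [set h] :|: Q)%SET = 0)).
Proof.

split; first by move=> H; exact: SliceInSet_image.
split=> [h|H F sF].
  have -> : SliceIn e D h = SliceInSet e D [set h]%SET.
    apply/seteqP; split=> f; last by move=> [_ /(_ h)]; apply; rewrite /= inE.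
    by move=> fh; split=> [|k]; [case: fh|rewrite /= inE => /eqP ->].
  rewrite SliceInSet_image //.
  have cE (K : {set 'I_n}) : (K \subset ~: [set h])%SET = (h \notin K).
    by rewrite finset.subsetC finset.sub1set inE.
  have ltE : ([set k : 'I_n | (h < k)%N] :\: [set h] = [set k : 'I_n | (h < k)%N])%SET.
    apply/finset.setP => k; rewrite !inE; case: eqP => // ->.
    by rewrite ltnn.
  congr [set slice_of e F | F in _]; apply/seteqP; split=> F [sF FE]; split=> //;
    rewrite [LHS]FE; apply/funext => z; rewrite big_set1 ltE;
    by congr (_ + _); apply: eq_bigl => K; rewrite cE.
rewrite (SliceInSetP hD H sF); split=> F0.
  move=> h Q P hH _ /fintype.subsetP Ph /eqP/finset.set0Pn[p pP] z.
  apply: (F0 h _ p) => //; rewrite ?inE ?pP ?eqxx ?orbT //.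
  by have := Ph p pP; rewrite inE.
move=> h K p z hH hK pK ph; rewrite (split_at hK).
apply: F0 => //; try exact: finset.subsetIr.
by apply/eqP/finset.set0Pn; exists p; rewrite !inE pK.
Qed.
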